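(* Let $k,n,p\ge1$, let $\{\mathcal{E}_1,\dots,\mathcal{E}_n\}$ be the standard ordered basis of $\mathbb{T}_p^n$ (that is, $\mathcal{E}_i$ has the tube $\delta=(1,0,\dots,0)$ in its $i$-th coordinate and the zero tube in all other coordinates). For a separately symmetric $t$-Hermitian $\mathbb{T}_p$-valued $(k,k)$-sesquilinear form $S$ on $\mathbb{T}_p^n$, define the tubes $$a_{i_1\dots i_kj_1\dots j_k}:=S(\mathcal{E}_{i_1},\dots,\mathcal{E}_{i_k};\mathcal{E}_{j_1},\dots,\mathcal{E}_{j_k})$$ and let $\mathcal{A}\in\mathbb{C}^{n\times\dots\times n\times p}$ be the order $2k+1$ hypermatrix with $\mathcal{A}[i_1,\dots,i_k,j_1,\dots,j_k,:]=a_{i_1\dots i_kj_1\dots j_k}$ for all $i_1,\dots,i_k,j_1,\dots,j_k\in[n]$. Then $$S(\mathcal{U}_1,\dots,\mathcal{U}_k;\mathcal{V}_1,\dots,\mathcal{V}_k)=\mathcal{A}*_t\big(J(\mathcal{U}_1),\dots,J(\mathcal{U}_k),\mathcal{V}_1,\dots,\mathcal{V}_k\big)$$ for all $\mathcal{U}_1,\dots,\mathcal{U}_k,\mathcal{V}_1,\dots,\mathcal{V}_k\in\mathbb{T}_p^n$, and consequently $\mathcal{A}$ is $t$-conjugate partially symmetric. Conversely, every order $2k+1$ $t$-conjugate partially symmetric hypermatrix $\mathcal{A}\in\mathbb{C}^{n\times\dots\times n\times p}$ defines, via this formula, a unique separately symmetric $t$-Hermitian $\mathbb{T}_p$-valued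 $(k,k)$-sesquilinear form.
   Context: Notation: $[m]=\{1,\dots,m\}$. $\mathbb{T}_p=\mathbb{C}^{1\times1\times p}\cong\mathbb{C}^p$ is the space of tubes, with product $a*_tb=a\circledast b$, where $(a\circledast b)[\ell]=\sum_{m=1}^p a[m]\,b[((\ell-m)\bmod p)+1]$, unit $\delta=(1,0,\dots,0)$, and involution (Fourier conjugation) $J(a)[\ell+1]=\overline{a[((-\ell)\bmod p)+1]}$ for $\ell=0,\dots,p-1$. $\mathbb{T}_p^n\cong\mathbb{C}^{n\times1\times p}$ is the free rank-$n$ module over the commutative algebra $\mathbb{T}_p$, with $\mathcal{U}[i,:]\in\mathbb{T}_p$ the $i$-th coordinate of $\mathcal{U}$; $J$ acts on $\mathbb{T}_p^n$ coordinatewise. A $\mathbb{T}_p$-valued $(k,k)$-sesquilinear form is a map $S:(\mathbb{T}_p^n)^{2k}\to\mathbb{T}_p$, written $S(\mathcal{U}_1,\dots,\mathcal{U}_k;\mathcal{V}_1,\dots,\mathcal{V}_k)$, which in each of its first $k$ arguments is $\mathbb{T}_p$-conjugate linear ($S(\dots,\mathcal{U}_i*_ta+\mathcal{W}_i*_tb,\dots)=J(a)*_tS(\dots,\mathcal{U}_i,\dots)+J(b)*_tS(\dots,\mathcal{W}_i,\dots)$) and in each of its last $k$ arguments is $\mathbb{T}_p$-linear. It is separately symmetric if $S(\mathcal{U}_{\sigma(1)},\dots,\mathcal{U}_{\sigma(k)};\mathcal{V}_{\tau(1)},\dots,\mathcal{V}_{\tau(k)})=S(\mathcal{U}_1,\dots,\mathcal{U}_k;\mathcal{V}_1,\dots,\mathcal{V}_k)$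 for all arguments and all $\sigma,\tau\in S_k$. It is $t$-Hermitian if $J\big(S(\mathcal{V}_1,\dots,\mathcal{V}_k;\mathcal{U}_1,\dots,\mathcal{U}_k)\big)=S(\mathcal{U}_1,\dots,\mathcal{U}_k;\mathcal{V}_1,\dots,\mathcal{V}_k)$ for all arguments. $t$-multilinear hypermatrix product: for $\mathcal{A}\in\mathbb{C}^{n\times\dots\times n\times p}$ of order $N+1$ and $\mathcal{X}^1,\dots,\mathcal{X}^N\in\mathbb{T}_p^n$, $\mathcal{A}*_t(\mathcal{X}^1,\dots,\mathcal{X}^N)=\sum_{i_1,\dots,i_N=1}^n\mathcal{A}[i_1,\dots,i_N,:]\circledast\mathcal{X}^1[i_1,:]\circledast\cdots\circledast\mathcal{X}^N[i_N,:]\in\mathbb{T}_p$. $t$-conjugate partial symmetry: for a tube $a$, $\widehat a[\ell]=\sum_{m=1}^p e^{-2\pi i(\ell-1)(m-1)/p}a[m]$; $\widehat{\mathcal{A}}$ is obtained by applying this transform along the last mode, and $\widehat{\mathcal{A}}_{(\ell)}$ is the order $2k$ hypermatrix with last index fixed to $\ell$. An order $2k$ hypermatrix $\mathcal{B}=[b_{i_1\dots i_kj_1\dots j_k}]$ is conjugate partially symmetric if $\overline{b_{j_{\sigma(1)}\dots j_{\sigma(k)}i_{\tau(1)}\dots i_{\tau(k)}}}=b_{i_1\dots i_kj_1\dots j_k}$ for all indices and all $\sigma,\tau\in S_k$; an order $2k+1$ hypermatrix $\mathcal{A}$ is $t$-conjugate partially symmetric if each $\widehat{\mathcal{A}}_{(\ell)}$,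 $\ell\in[p]$, is conjugate partially symmetric. *)

(* Defs.v *)
From HB Require Import structures.
From mathcomp Require Import all_boot all_order all_algebra perm.
From mathcomp Require Import complex.
From mathcomp Require Import reals trigo.

Set Implicit Arguments.
Unset Strict Implicit.
Unset Printing Implicit Defensive.

Import GRing.Theory.
Local Open Scope ring_scope.

(* Complex numbers are R[i] for R : realType.  All indices are 0-based:
   'I_p stands for {1, ..., p}, shifted by one. *)

(* (l - m) mod p and (- l) mod p on 'I_p; p is not assumed to be a successor,
   its positivity comes from the index itself. *)
Definition cyc_sub (p : nat) (l m : 'I_p) : 'I_p :=
  Ordinal (ltn_pmod (l + (p - m)) (leq_ltn_trans (leq0n l) (ltn_ord l))).

Definition cyc_opp (p : nat) (l : 'I_p) : 'I_p :=
  Ordinal (ltn_pmod (p - l) (leq_ltn_trans (leq0n l) (ltn_ord l))).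

(* An alias of 'rV, so that the circular convolution can be declared as its
   product without interfering with matrix multiplication. *)
Definition tube (R : realType) (p : nat) : Type := 'rV[R[i]]_p.

HB.instance Definition _ (R : realType) (p : nat) :=
  GRing.Zmodule.copy (tube R p) 'rV[R[i]]_p.

Definition tmul (R : realType) (p : nat) (a b : tube R p) : tube R p :=
  \row_l \sum_(m < p) a 0 m * b 0 (cyc_sub l m).

Definition tunit (R : realType) (p : nat) : tube R p :=
  \row_l (l == 0 :> nat)%:R.

Section TubeRing.
Variables (R : realType) (p : nat).
Implicit Types a b c : tube R p.

Lemma cyc_subE (q : nat) (l m : 'I_q.+1) : cyc_sub l m = l - m.
Proof. by apply: val_inj; rewrite /= modnDmr. Qed.

Lemma cyc_oppE (q : nat) (l : 'I_q.+1) : cyc_opp l = - l.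
Proof. exact: val_inj. Qed.

Lemma tmulC : commutative (@tmul R p).
Proof.
case: p => [|q] a b; apply/rowP=> l; first by case: l.
rewrite !mxE (reindex_inj (inv_inj (subKr l))) /=.
by apply: eq_bigr => m _; rewrite !cyc_subE subKr mulrC.
Qed.

Lemma tmulA : associative (@tmul R p).
Proof.
case: p => [|q] a b c; apply/rowP=> l; first by case: l.
rewrite !mxE.
under eq_bigr => m _ do rewrite mxE mulr_sumr.
under [RHS]eq_bigr => m _ do rewrite mxE mulr_suml.
rewrite [RHS]exchange_big /=; apply: eq_bigr => m _.
rewrite [RHS](reindex_inj (addrI m)) /=; apply: eq_bigr => j _.
by rewrite !cyc_subE mulrA [m + j]addrC addrK opprD addrCA addrC addrAC.
Qed.

Lemma tmul1 : left_id (tunit R p) (@tmul R p).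
Proof.
case: p => [|q] a; apply/rowP=> l; first by case: l.
rewrite !mxE (bigD1 ord0) //= big1 => [|m m0].
  by rewrite mxE mul1r addr0 cyc_subE subr0.
have /negPf m0' : m != 0 :> nat by [].
by rewrite mxE m0' mul0r.
Qed.

Lemma tmulDl : left_distributive (@tmul R p) +%R.
Proof.
move=> a b c; apply/rowP=> l; rewrite !mxE -big_split /=.
by apply: eq_bigr => m _; rewrite mxE mulrDl.
Qed.

HB.instance Definition _ :=
  GRing.Zmodule_isComPzRing.Build (tube R p) tmulA tmulC tmul1 tmulDl.

End TubeRing.

(* The free module of rank n over the ring of tubes is 'cV[tube R p]_n: the
   i-th coordinate of U is U i 0, scaling is a *: U = U * a (the ring is
   commutative), and the standard basis is given by delta_mx i 0. *)
Definition tbasis (R : realType) (n p : nat) (i : 'I_n) : 'cV[tube R p]_n :=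
  delta_mx i 0.

Definition tconj (R : realType) (p : nat) (a : tube R p) : tube R p :=
  \row_l ((a 0 (cyc_opp l))^*)%C.

Definition tvconj (R : realType) (n p : nat) (U : 'cV[tube R p]_n) :
  'cV[tube R p]_n := map_mx (@tconj R p) U.

(* exp (i t) for real t *)
Definition expi (R : realType) (t : R) : R[i] := (cos t +i* sin t)%C.

Definition tdft (R : realType) (p : nat) (a : tube R p) : 'rV[R[i]]_p :=
  \row_l \sum_(m < p) expi (- (2 * pi * (l * m)%:R / p%:R)) * a 0 m.

Definition permute (T : Type) (k : nat) (s : 'S_k) (x : k.-tuple T) :
  k.-tuple T := [tuple tnth x (s r) | r < k].

Definition update (T : Type) (k : nat) (x : k.-tuple T) (r : 'I_k) (y : T) :
  k.-tuple T := [tuple if q == r then y else tnth x q | q < k].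

(* A hypermatrix of order N with all modes of size n. *)
Definition hypermatrix (T : Type) (n N : nat) : Type := N.-tuple 'I_n -> T.

(* A complex hypermatrix of order N.+1, with last mode of size p, is given by
   its tubes A[i_1, ..., i_N, :], i.e., has type hypermatrix (tube R p) n N. *)
Definition tprod (R : realType) (n p N : nat)
    (A : hypermatrix (tube R p) n N) (X : N.-tuple 'cV[tube R p]_n) :
  tube R p :=
  \sum_(I : N.-tuple 'I_n) A I * \prod_(s < N) tnth X s (tnth I s) 0.

Definition conj_partially_symmetric (R : realType) (n k : nat)
    (B : hypermatrix R[i] n (k + k)) : Prop :=
  forall (I J : k.-tuple 'I_n) (s t : 'S_k),
    ((B [tuple of permute s J ++ permute t I])^*)%C = B [tuple of I ++ J].

Definition t_conj_partially_symmetric (R : realType) (n p k : nat)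
    (A : hypermatrix (tube R p) n (k + k)) : Prop :=
  forall l : 'I_p, conj_partially_symmetric (fun K => tdft (A K) 0 l).

Section Forms.
Variables (R : realType) (n p k : nat).
Local Notation V := 'cV[tube R p]_n.

Definition sesquilinear (S : k.-tuple V -> k.-tuple V -> tube R p) : Prop :=
  (forall (r : 'I_k) (us vs : k.-tuple V) (u w : V) (a b : tube R p),
     S (update us r (a *: u + b *: w)) vs =
     tconj a * S (update us r u) vs + tconj b * S (update us r w) vs) /\
  (forall (r : 'I_k) (us vs : k.-tuple V) (v w : V) (a b : tube R p),
     S us (update vs r (a *: v + b *: w)) =
     a * S us (update vs r v) + b * S us (update vs r w)).

Definition separately_symmetric (S : k.-tuple V -> k.-tuple V -> tube R p) :
  Prop :=
  forall (us vs : k.-tuple V) (s t : 'S_k),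
    S (permute s us) (permute t vs) = S us vs.

Definition t_hermitian (S : k.-tuple V -> k.-tuple V -> tube R p) : Prop :=
  forall us vs : k.-tuple V, tconj (S vs us) = S us vs.

End Forms.

(* Main.v *)
(* A form that is semilinear in each slot is determined by its values on tuples
   of basis vectors, which gives the representation formula.  The discrete
   Fourier transform is injective and turns [J] into entrywise complex
   conjugation, so t-conjugate partial symmetry of A is the tube identity
   J(a_{s(j) t(i)}) = a_{ij}; this is what being Hermitian and separately
   symmetric says on basis vectors, and it transfers to all vectors by
   reindexing the sum that defines the form. *)

From HB Require Import structures.
Require Import Defs.
From mathcomp Require Import all_boot all_order all_algebra perm.
From mathcomp Require Import complex.
From mathcomp Require Import boolp reals trigo.
From mathcomp Require Import ring.

Set Implicit Arguments.
Unset Strict Implicit.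
Unset Printing Implicit Defensive.

Import Order.TTheory GRing.Theory Num.Theory.
Local Open Scope ring_scope.

(** * Roots of unity on the complex unit circle *)

Section RootsOfUnity.
Variable R : realType.
Implicit Types x y : R.

Lemma expiD x y : expi (x + y) = expi x * expi y.
Proof.
by apply/eqP; rewrite /expi cosD sinD eq_complex /= eqxx addrC eqxx.
Qed.

Lemma expi0 : expi (0 : R) = 1.
Proof. by rewrite /expi cos0 sin0. Qed.

Lemma expiX x m : expi x ^+ m = expi (x *+ m).
Proof.
elim: m => [|m IHm]; first by rewrite expr0 mulr0n expi0.
by rewrite exprS IHm mulrS expiD.
Qed.

Lemma conjc_expi x : ((expi x)^*)%C = expi (- x).
Proof. by rewrite /expi cosN sinN. Qed.

Lemma expiM_conj x : expi x * expi (- x) = 1.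
Proof. by rewrite -expiD subrr expi0. Qed.

(** Comparing real parts would give [cos x = 1], whereas [cos x = 1 - 2 sin(x/2)^2] and [sin] is
    positive on the open interval from 0 to [pi], which contains [x / 2]. *)
Lemma expi_neq1 x : 0 < x < 2 * pi -> expi x != 1.
Proof.
move=> /andP[x0 x2pi]; apply/eqP=> /(congr1 (@complex.Re R)) /= cosx.
have : 0 < sin (x / 2).
  apply: sin_gt0_pi; rewrite divr_gt0 //=.
  by rewrite ltr_pdivrMr // mulrC.
have : cos x = 1 - sin (x / 2) ^+ 2 *+ 2.
  rewrite {1}[x](_ : _ = (x / 2) *+ 2) ?cos_mulr2n ?cos2sin2; last by field.
  by rewrite mulrnBl [RHS]addrC mulr2n addrAC addrK addrC.
rewrite cosx => /eqP; rewrite -subr_eq0 opprB addrCA subrr addr0.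
by rewrite mulrn_eq0 /= sqrf_eq0 => /eqP ->; rewrite ltxx.
Qed.

(** The minus sign matches the kernel of [tdft], whose entries are thereby powers of this root. *)
Definition unity_root (p : nat) : R[i] := expi (- (2 * pi / p%:R)).

Lemma unity_rootX (p m : nat) :
  unity_root p ^+ m = expi (- (2 * pi * m%:R / p%:R)).
Proof. by rewrite /unity_root expiX mulNrn [_ * m%:R]mulr_natr [_ *+ m / _]mulrnAl. Qed.

Lemma unity_rootXp (p : nat) : unity_root p ^+ p = 1.
Proof.
rewrite unity_rootX; case: p => [|p]; first by rewrite mulr0 mul0r oppr0 expi0.
rewrite mulfK ?pnatr_eq0 // -[2]/(1 *+ 2) mulr_natl.
by rewrite /expi cosN sinN cos2pi sin2pi oppr0.
Qed.

(** If the powers with exponents [l < m] agree, cancelling gives a trivial power with exponent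
    [m - l] strictly between 0 and [p], which [expi_neq1] excludes. *)
Lemma unity_root_inj (p : nat) :
  injective (fun l : 'I_p => unity_root p ^+ l).
Proof.
move=> l m; wlog lm : l m / (l <= m)%N.
  by move=> H lm; case/orP: (leq_total l m) => /H ->.
move=> e; apply/val_inj/eqP; rewrite eqn_leq lm leqNgt /=; apply/negP=> ltlm.
have p0 : (0 < p)%N by exact: leq_ltn_trans (ltn_ord l).
have w0 : unity_root p != 0.
  apply/eqP=> w0; have := unity_rootXp p; rewrite w0 expr0n gtn_eqF // => /eqP.
  by rewrite eq_sym oner_eq0.
have : unity_root p ^+ (m - l) = 1.
  by apply: (mulIf (expf_neq0 l w0)); rewrite -exprD subnK // mul1r.
(* Conjugation makes the angle positive, as [expi_neq1] requires. *)
rewrite unity_rootX => /(congr1 (@conjc R)); rewrite conjc_expi opprK conjc1.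
apply/eqP/expi_neq1; rewrite divr_gt0 ?mulr_gt0 ?pi_gt0 ?ltr0n ?subn_gt0 //=.
rewrite ltr_pdivrMr ?ltr0n // ltr_pM2l ?mulr_gt0 ?pi_gt0 // ltr_nat.
exact: leq_ltn_trans (leq_subr _ _) (ltn_ord m).
Qed.

End RootsOfUnity.

(** * Fourier transform and involution on tubes *)

Section Tubes.
Variables (R : realType) (p : nat).
Implicit Types a b : tube R p.

Lemma tdftE a l : tdft a 0 l = \sum_(m < p) a 0 m * (unity_root R p ^+ l) ^+ m.
Proof.
rewrite mxE; apply: eq_bigr => m _; rewrite mulrC; congr (_ * _).
by rewrite -exprM unity_rootX.
Qed.

(** The polynomial with coefficients [a - b] has size at most [p] and vanishes at the [p] distinct
    powers of [unity_root], so it is zero. *)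
Lemma tdft_inj : injective (@tdft R p).
Proof.
move=> a b /rowP ab.
(* The default 0 is never reached: [insub m] succeeds for every [m < p]. *)
pose P := \poly_(m < p) (if insub m is Some i then a 0 i - b 0 i else 0).
suff P0 : P = 0.
  apply/rowP=> l; apply/eqP; rewrite -subr_eq0.
  by have := coef0 R[i] l; rewrite -P0 coef_poly ltn_ord valK => ->.
apply: (@roots_geq_poly_eq0 _ _
  [seq unity_root R p ^+ (l : 'I_p) | l <- enum 'I_p]).
- apply/allP=> _ /mapP[l _ ->]; apply/eqP; rewrite horner_poly.
  under eq_bigr => m _ do rewrite valK mulrBl.
  by rewrite sumrB -!tdftE ab subrr.
- by rewrite map_inj_uniq ?enum_uniq //; exact: unity_root_inj.
- by rewrite size_map size_enum_ord size_poly.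
Qed.

Lemma tconjE (q : nat) (a : tube R q.+1) l : tconj a 0 l = ((a 0 (- l))^*)%C.
Proof. by rewrite mxE cyc_oppE. Qed.

Lemma tconjK : involutive (@tconj R p).
Proof.
case: p => [|q] a; apply/rowP=> l; first by case: l.
by rewrite !tconjE opprK conjcK.
Qed.

Lemma tconj_is_zmod_morphism : zmod_morphism (@tconj R p).
Proof. by move=> a b; apply/rowP=> l; rewrite !mxE rmorphB. Qed.

Lemma tconj_is_monoid_morphism : monoid_morphism (@tconj R p).
Proof.
split=> [|a b]; apply/rowP.
  case: p => [[]//|q] l; rewrite tconjE !mxE conjc_nat.
  (* The test on natural numbers in [tunit] is convertible to equality in the cyclic group of
     indices. *)
  by rewrite -[_ == 0%N]/(- l == 0) oppr_eq0.
case: p a b => [|q] a b l; first by case: l.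
rewrite tconjE !mxE rmorph_sum (reindex_inj oppr_inj) /=.
apply: eq_bigr => m _.
by rewrite rmorphM !tconjE !cyc_subE opprD !opprK addrC.
Qed.

HB.instance Definition _ := GRing.isZmodMorphism.Build _ _ (@tconj R p)
  tconj_is_zmod_morphism.
HB.instance Definition _ := GRing.isMonoidMorphism.Build _ _ (@tconj R p)
  tconj_is_monoid_morphism.

End Tubes.

(** Substituting [- m] for [m] undoes the index reversal in [tconj]; the kernel is then conjugated
    because a root of unity has its conjugate as inverse. *)
Lemma tdft_tconj (R : realType) (p : nat) (a : tube R p) l :
  tdft (tconj a) 0 l = ((tdft a 0 l)^*)%C.
Proof.
case: p a l => [|q] a l; first by case: l.
rewrite !tdftE rmorph_sum (reindex_inj oppr_inj) /=; apply: eq_bigr => m _.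
rewrite tconjE opprK rmorphM !rmorphXn /=; congr (_ * _).
have wK : unity_root R q.+1 * ((unity_root R q.+1)^*)%C = 1.
  by rewrite conjc_expi expiM_conj.
rewrite -!exprM; set w := unity_root _ _ in wK *.
have wl : (w ^+ l) ^+ q.+1 = 1 by rewrite -exprM mulnC exprM unity_rootXp expr1n.
have wKX N : w ^+ N * (w^*)%C ^+ N = 1 by rewrite -exprMn wK expr1n.
(* [- m] is a residue modulo [q.+1], so the exponents of [w ^+ l] add up to 0 only modulo [q.+1];
   this suffices by [wl]. *)
have e : w ^+ (l * (- m : 'I_q.+1)) * w ^+ (l * m) = 1.
  rewrite !(exprM w) -exprD /=.
  rewrite -[RHS](expr0 (w ^+ l)); apply/eqP.
  have /(expr_mod) H := wl; rewrite -H modnDml subnK ?modnn //.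
  exact/ltnW.
by rewrite -[LHS]mulr1 -(wKX (l * m)%N) mulrA e mul1r.
Qed.

(** * Updates, permutations and big operators over tuples *)

Section Tuples.

Lemma tnth_update (T : Type) (k : nat) (x : k.-tuple T) (r q : 'I_k) (y : T) :
  tnth (update x r y) q = if q == r then y else tnth x q.
Proof. by rewrite tnth_mktuple. Qed.

Lemma update_cons0 (T : Type) (k : nat) (y z : T) (x : k.-tuple T) :
  update [tuple of y :: x] ord0 z = [tuple of z :: x].
Proof.
apply: eq_from_tnth => i; rewrite tnth_update.
by case: (unliftP ord0 i) => [j|] ->; rewrite ?tnthS ?tnth0.
Qed.

Lemma update_consS (T : Type) (k : nat) (y z : T) (x : k.-tuple T) (r : 'I_k) :
  update [tuple of y :: x] (lift ord0 r) z = [tuple of y :: update x r z].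
Proof.
apply: eq_from_tnth => i; rewrite tnth_update.
case: (unliftP ord0 i) => [j|] ->; last by rewrite !tnth0.
by rewrite (inj_eq lift_inj) !tnthS tnth_update.
Qed.

Lemma update_cat_l (T : Type) (k m : nat) (x : k.-tuple T) (y : m.-tuple T) r z :
  [tuple of update x r z ++ y] = update [tuple of x ++ y] (lshift m r) z.
Proof.
apply: eq_from_tnth => i; rewrite tnth_update.
case: (split_ordP i) => j ->; last by rewrite !tnth_rshift eq_rlshift.
by rewrite !tnth_lshift tnth_update eq_lshift.
Qed.

Lemma update_cat_r (T : Type) (k m : nat) (x : k.-tuple T) (y : m.-tuple T) r z :
  [tuple of x ++ update y r z] = update [tuple of x ++ y] (rshift k r) z.
Proof.
apply: eq_from_tnth => i; rewrite tnth_update.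
case: (split_ordP i) => j ->; first by rewrite !tnth_lshift eq_lrshift.
by rewrite !tnth_rshift tnth_update eq_rshift.
Qed.

Lemma map_update (T U : Type) (f : T -> U) (k : nat) (x : k.-tuple T) r z :
  map_tuple f (update x r z) = update (map_tuple f x) r (f z).
Proof.
by apply: eq_from_tnth => i; rewrite tnth_map !tnth_update tnth_map; case: eqP.
Qed.

Lemma map_permute (T U : Type) (f : T -> U) (k : nat) (s : 'S_k) (x : k.-tuple T) :
  map_tuple f (permute s x) = permute s (map_tuple f x).
Proof. by apply: eq_from_tnth => i; rewrite tnth_map !tnth_mktuple tnth_map. Qed.

Lemma permute1 (T : Type) (k : nat) (x : k.-tuple T) : permute 1 x = x.
Proof. by apply: eq_from_tnth => i; rewrite tnth_mktuple perm1. Qed.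

Lemma permuteK (T : Type) (k : nat) (s : 'S_k) :
  cancel (@permute T k s) (permute s^-1).
Proof. by move=> x; apply: eq_from_tnth => i; rewrite !tnth_mktuple permKV. Qed.

Variables (T : Type) (idx : T) (op : Monoid.com_law idx) (I : finType).

Lemma big_tuple_cons (k : nat) (F : k.+1.-tuple I -> T) :
  \big[op/idx]_(t : k.+1.-tuple I) F t =
  \big[op/idx]_i \big[op/idx]_(t : k.-tuple I) F [tuple of i :: t].
Proof.
rewrite pair_bigA /= (reindex (fun u : I * k.-tuple I => [tuple of u.1 :: u.2])) //=.
exists (fun t => (thead t, [tuple of behead t])) => [[i t]|t] _ /=.
  by congr (_, _); apply: val_inj.
by rewrite -tuple_eta.
Qed.

Lemma big_tuple_cat (k m : nat) (F : (k + m).-tuple I -> T) :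
  \big[op/idx]_(t : (k + m).-tuple I) F t =
  \big[op/idx]_(t : k.-tuple I) \big[op/idx]_(u : m.-tuple I) F [tuple of t ++ u].
Proof.
rewrite pair_bigA /=.
rewrite (reindex (fun u : k.-tuple I * m.-tuple I => [tuple of u.1 ++ u.2])) //=.
exists (fun t : (k + m).-tuple I => ([tuple tnth t (lshift m i) | i < k],
                    [tuple tnth t (rshift k i) | i < m])) => [[t u]|t] _ /=.
  by congr (_, _); apply: eq_from_tnth => i;
    rewrite tnth_mktuple (tnth_lshift, tnth_rshift).
apply: eq_from_tnth => i.
by case: (split_ordP i) => j ->; rewrite (tnth_lshift, tnth_rshift) tnth_mktuple.
Qed.

End Tuples.

(** * Expansion of multisemilinear maps on the standard basis *)

Section Multisemilinear.
Variables (T : comPzRingType) (phi : {rmorphism T -> T}) (n : nat).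
Local Notation V := 'cV[T]_n.

(** The twist [phi] treats both halves of a sesquilinear form at once: [tconj] for the first [k]
    slots, [idfun] for the last [k]. *)
Definition multisemilinear (k : nat) (f : k.-tuple V -> T) : Prop :=
  forall r x u w a b, f (update x r (a *: u + b *: w)) =
    phi a * f (update x r u) + phi b * f (update x r w).

Lemma semilinear_expand (g : V -> T) :
  (forall u w a b, g (a *: u + b *: w) = phi a * g u + phi b * g w) ->
  forall u, g u = \sum_i phi (u i 0) * g (delta_mx i 0).
Proof.
move=> g_lin u.
have g0 : g 0 = 0.
  by have := g_lin 0 0 0 0; rewrite !scale0r addr0 rmorph0 !mul0r addr0.
have {1}-> : u = \sum_i u i 0 *: delta_mx i 0.
  by rewrite {1}[u]matrix_sum_delta; apply: eq_bigr => i _; rewrite big_ord1.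
elim: (index_enum _) => [|i r IHr]; first by rewrite !big_nil.
(* The tail of the sum is given coefficient 1 so that [g_lin] applies. *)
by rewrite !big_cons -IHr -[X in g (_ + X)]scale1r g_lin rmorph1 mul1r.
Qed.

(** Induction on the number of slots: expand the first one by [semilinear_expand], then the
    remaining ones with a basis vector frozen in front. *)
Lemma multisemilinear_expand (k : nat) (f : k.-tuple V -> T) :
  multisemilinear f -> forall x : k.-tuple V,
  f x = \sum_(I : k.-tuple 'I_n) f (map_tuple (fun i => delta_mx i 0) I) *
          \prod_s phi (tnth x s (tnth I s) 0).
Proof.
elim: k f => [|k IHk] f f_lin x.
  rewrite (big_pred1 [tuple]) => [|t]; last by apply/esym/eqP/tuple0.
  by rewrite big_ord0 mulr1; congr f; rewrite tuple0; apply/esym/tuple0.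
case/tupleP: x => [y x]; rewrite big_tuple_cons.
rewrite (semilinear_expand (g := fun u => f [tuple of u :: x])); last first.
  (* The head [y] is a placeholder, overwritten by the update. *)
  by move=> u w a b; have := f_lin ord0 [tuple of y :: x] u w a b;
    rewrite !update_cons0.
apply: eq_bigr => i _.
rewrite (IHk (fun x => f [tuple of delta_mx i 0 :: x])); last first.
  move=> r z u w a b.
  by have := f_lin (lift ord0 r) [tuple of delta_mx i 0 :: z] u w a b;
    rewrite !update_consS.
rewrite mulr_sumr; apply: eq_bigr => I _.
rewrite big_ord_recl !tnth0 mulrCA; congr (f _ * (_ * _)); first exact: val_inj.
by apply: eq_bigr => s _; rewrite !tnthS.
Qed.

End Multisemilinear.

(** * The form defined by a hypermatrix *)

Section HypermatrixForm.
Variables (R : realType) (n p : nat).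
Local Notation V := 'cV[tube R p]_n.

Lemma tvconjP (a b : tube R p) (u w : V) :
  tvconj (a *: u + b *: w) = tconj a *: tvconj u + tconj b *: tvconj w.
Proof.
apply/colP=> i; rewrite [LHS]mxE ![in RHS]mxE ![in LHS]mxE.
by rewrite rmorphD !rmorphM.
Qed.

(** Each summand contains exactly one factor from slot [r], and the other factors ignore the
    update. *)
Lemma tprod_update N (A : hypermatrix (tube R p) n N) :
  multisemilinear idfun (tprod A).
Proof.
move=> r x u w a b; rewrite /tprod !mulr_sumr -big_split /=.
apply: eq_bigr => I _.
have prodE z : \prod_(s < N) tnth (update x r z) s (tnth I s) 0 =
    z (tnth I r) 0 * \prod_(s < N | s != r) tnth x s (tnth I s) 0.
  rewrite (bigD1 r) //= tnth_update eqxx; congr (_ * _).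
  by apply: eq_bigr => s /negPf sr; rewrite tnth_update sr.
rewrite !prodE.
have -> : (a *: u + b *: w) (tnth I r) 0 =
    a * u (tnth I r) 0 + b * w (tnth I r) 0.
  by rewrite mxE [X in X + _]mxE [X in _ + X]mxE.
by rewrite mulrDl mulrDr -!mulrA ![A I * (_ * _)]mulrCA.
Qed.

Lemma tprod_cat k m (A : hypermatrix (tube R p) n (k + m))
    (x : k.-tuple V) (y : m.-tuple V) :
  tprod A [tuple of x ++ y] =
  \sum_(I : k.-tuple 'I_n) \sum_(J : m.-tuple 'I_n) A [tuple of I ++ J] *
    (\prod_s tnth x s (tnth I s) 0 * \prod_s tnth y s (tnth J s) 0).
Proof.
rewrite /tprod big_tuple_cat; apply: eq_bigr => I _; apply: eq_bigr => J _.
rewrite big_split_ord; congr (_ * (_ * _)); apply: eq_bigr => s _.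
  by rewrite !tnth_lshift.
by rewrite !tnth_rshift.
Qed.

Variable k : nat.

Lemma t_conj_partially_symmetricP (A : hypermatrix (tube R p) n (k + k)) :
  t_conj_partially_symmetric A <->
  (forall (I J : k.-tuple 'I_n) (s t : 'S_k),
     tconj (A [tuple of permute s J ++ permute t I]) = A [tuple of I ++ J]).
Proof.
split=> [symA I J s t|symA l I J s t]; last by rewrite -tdft_tconj symA.
by apply/tdft_inj/rowP=> l; rewrite tdft_tconj symA.
Qed.

Definition hform (A : hypermatrix (tube R p) n (k + k)) (us vs : k.-tuple V) :
  tube R p := tprod A [tuple of map_tuple (@tvconj R n p) us ++ vs].

Lemma hformE A us vs : hform A us vs =
  \sum_(I : k.-tuple 'I_n) \sum_(J : k.-tuple 'I_n) A [tuple of I ++ J] *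
    (\prod_s tconj (tnth us s (tnth I s) 0) * \prod_s tnth vs s (tnth J s) 0).
Proof.
rewrite /hform tprod_cat; apply: eq_bigr => I _; apply: eq_bigr => J _.
by congr (_ * (_ * _)); apply: eq_bigr => s _; rewrite tnth_map mxE.
Qed.

Lemma hform_sesquilinear A : sesquilinear (hform A).
Proof.
split=> r us vs u w a b; rewrite /hform.
  by rewrite !map_update !update_cat_l tvconjP tprod_update.
by rewrite !update_cat_r tprod_update.
Qed.

Lemma hform_separately_symmetric A :
  t_conj_partially_symmetric A -> separately_symmetric (hform A).
Proof.
move=> /t_conj_partially_symmetricP symA us vs s t.
(* Both sides have the same image under [tconj], namely the entry at [J ++ I]: use [symA] once with
   [s], [t] and once with identities. *)
have permA I J : A [tuple of permute s I ++ permute t J] = A [tuple of I ++ J].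
  apply: (inv_inj (@tconjK R p)); rewrite symA -(symA J I 1%g 1%g).
  by rewrite !permute1.
(* Permuting the multi-indices along with the vectors leaves the entry of [A] unchanged by [permA],
   and each product is merely reordered. *)
rewrite !hformE (reindex_inj (can_inj (permuteK s))) /=.
apply: eq_bigr => I _; rewrite (reindex_inj (can_inj (permuteK t))) /=.
apply: eq_bigr => J _; rewrite permA; congr (_ * (_ * _)).
  by rewrite [RHS](reindex_inj (@perm_inj _ s)) /=; apply: eq_bigr => r _;
    rewrite !tnth_mktuple.
by rewrite [RHS](reindex_inj (@perm_inj _ t)) /=; apply: eq_bigr => r _;
  rewrite !tnth_mktuple.
Qed.

(** [tconj] is an involutive ring morphism, so it passes through the sum, moves the conjugation to
    the other family of vectors and swaps [I] and [J] in [A]. *)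
Lemma hform_hermitian A :
  t_conj_partially_symmetric A -> t_hermitian (hform A).
Proof.
move=> /t_conj_partially_symmetricP symA us vs.
rewrite !hformE rmorph_sum [RHS]exchange_big; apply: eq_bigr => I _.
rewrite rmorph_sum; apply: eq_bigr => J _.
have := symA J I 1%g 1%g; rewrite !permute1 !rmorphM /= => ->.
rewrite [X in _ * X]mulrC !rmorph_prod; congr (_ * (_ * _)).
by apply: eq_bigr => s _ /=; rewrite tconjK.
Qed.

(** Expand the conjugate-linear slots with [vs] fixed, then the linear slots with basis vectors on
    the left. *)
Lemma sesquilinear_expand (S : k.-tuple V -> k.-tuple V -> tube R p) A :
  sesquilinear S ->
  (forall I J : k.-tuple 'I_n, A [tuple of I ++ J] =
     S (map_tuple (@tbasis R n p) I) (map_tuple (@tbasis R n p) J)) ->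
  forall us vs, S us vs = hform A us vs.
Proof.
move=> [S_l S_r] AE us vs; rewrite hformE.
rewrite (@multisemilinear_expand _ (@tconj R p) _ _ (S^~ vs)); last first.
  by move=> r x u w a b; rewrite S_l.
apply: eq_bigr => I _.
rewrite (@multisemilinear_expand _ idfun _ _ (S _)); last first.
  by move=> r x u w a b; rewrite S_r.
rewrite mulr_suml; apply: eq_bigr => J _.
by rewrite AE -mulrA [X in _ * X]mulrC.
Qed.

End HypermatrixForm.

Theorem proposition3p24 (R : realType) (k n p : nat)
    (hk : (1 <= k)%N) (hn : (1 <= n)%N) (hp : (1 <= p)%N) :
  (forall S : k.-tuple 'cV[tube R p]_n -> k.-tuple 'cV[tube R p]_n -> tube R p,
     sesquilinear S -> separately_symmetric S -> t_hermitian S ->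
   forall A : hypermatrix (tube R p) n (k + k),
     (forall I J : k.-tuple 'I_n,
        A [tuple of I ++ J] =
        S (map_tuple (@tbasis R n p) I) (map_tuple (@tbasis R n p) J)) ->
     (forall us vs : k.-tuple 'cV[tube R p]_n,
        S us vs = tprod A [tuple of map_tuple (@tvconj R n p) us ++ vs]) /\
     t_conj_partially_symmetric A) /\
  (forall A : hypermatrix (tube R p) n (k + k),
     t_conj_partially_symmetric A ->
     exists! S : k.-tuple 'cV[tube R p]_n -> k.-tuple 'cV[tube R p]_n ->
                 tube R p,
       [/\ sesquilinear S, separately_symmetric S, t_hermitian S &
        forall us vs : k.-tuple 'cV[tube R p]_n,
          S us vs = tprod A [tuple of map_tuple (@tvconj R n p) us ++ vs]]).
Proof.
split=> [S S_lin S_sym S_herm A AE|A symA].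
  split; first exact: sesquilinear_expand.
  apply/t_conj_partially_symmetricP=> I J s t.
  by rewrite !AE S_herm !map_permute S_sym.
exists (hform A); split=> [|S' [_ _ _ S'E]].
  split=> //; first exact: hform_sesquilinear.
    exact: hform_separately_symmetric.
  exact: hform_hermitian.
(* Uniqueness: the formula prescribes every value of the form, and extensionality makes this
   equality of functions. *)
by apply/funext=> us; apply/funext=> vs; rewrite S'E.
Qed.
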